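(* Assume that the Boolean algebra $\mathcal{P}(\mathbb{N})$ is $(\aleph_1,\aleph_0)$-ideal. If $X$ is a regular space in which $\mathbb{N}$ is (embedded as) a countable dense subset and every infinite subset of $\mathbb{N}$ contains a sequence converging in $X$, then $X$ has cardinality at most $2^{\aleph_1}$.
   Context: Regular spaces are Hausdorff. A subalgebra $A$ of a Boolean algebra $B$ is \emph{$\aleph_0$-ideal} if for each $b\in B\setminus A$ the ideal $\{a\in A: a<b\}$ of $A$ has a countable cofinal subset. A Boolean algebra $B$ is \emph{$(\aleph_1,\aleph_0)$-ideal} if there is a family $\mathcal{A}$ of $\aleph_0$-ideal subalgebras of $B$, each of cardinality $\aleph_1$, such that every subset of $B$ of size $\aleph_1$ is contained in some member of $\mathcal{A}$ and the union of each chain from $\mathcal{A}$ of cofinality $\omega_1$ is again in $\mathcal{A}$. *)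

(* Defs.v *)
From HB Require Import structures.
From mathcomp Require Import all_boot all_order.
From mathcomp Require Import all_classical wochoice.
From mathcomp Require Import topology.

Set Implicit Arguments.
Unset Strict Implicit.
Unset Printing Implicit Defensive.

Local Open Scope classical_set_scope.
Local Open Scope card_scope.

(* The ordinal omega_1, realised inside [set nat] equipped with a well-ordering:
   the elements with countably many predecessors form its unique uncountable
   initial segment all of whose proper initial segments are countable. Only the
   cardinality aleph_1 of [omega1] is used, so the choice of the well-ordering
   is immaterial. *)
Definition set_nat_le : rel (set nat) := sval (well_ordering_principle (set nat)).

Definition omega1 : set (set nat) :=
  [set x | countable [set y | set_nat_le y x]].

Lemma set_nat_le_wo : well_order set_nat_le.
Proof. exact: svalP (well_ordering_principle (set nat)). Qed.

Lemma set_nat_le_chain : wo_chain set_nat_le predT.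
Proof. by move=> A _; exact: set_nat_le_wo. Qed.

Lemma uncountable_set_nat : ~ countable [set: set nat].
Proof.
move=> /countable_injP[f finj].
pose D : set nat := [set n | exists2 S, f S = n & ~ S n].
have DfD : D (f D) -> False.
  move=> h; case: (h) => S /finj; rewrite !inE => /(_ I I) ->; exact.
by apply: (DfD); exists D.
Qed.

Lemma uncountable_omega1 : ~ countable omega1.
Proof.
move=> cO.
have [x Ox] : exists x, ~ omega1 x.
  apply: contrapT => /forallNP h; apply: uncountable_set_nat.
  by apply: sub_countable cO; apply: subset_card_le => x _; apply: contrapT.
have [|m [[mO mmin] _]] := set_nat_le_wo (A := [pred y | y \notin omega1]).
  by exists x; rewrite inE notin_setE.
have mO' : ~ omega1 m by move: mO; rewrite inE notin_setE.
have nle y : set_nat_le y m -> y = m \/ omega1 y.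
  move=> ym; have [Oy|nOy] := pselect (omega1 y); [by right | left].
  apply: (wo_chain_antisymmetric set_nat_le_chain) => //.
  by rewrite ym mmin// inE notin_setE.
apply: mO'; rewrite /omega1 /=.
apply: (@sub_countable _ _ _ (\bigcup_(b in [set: bool])
  (if b then [set m] else omega1))).
  by apply: subset_card_le => y /nle[->|Oy]; [exists true | exists false].
by apply: bigcup_countable => // -[] _ //; exact: countable1.
Qed.

Definition has_card_aleph1 (T : Type) (A : set T) : Prop := A #= omega1.

Definition card_le_exp2_aleph1 (T : Type) (A : set T) : Prop :=
  A #<= [set S : set (set nat) | S `<=` omega1].

Definition cofinal_in (T : Type) (le : T -> T -> Prop) (D C : set T) : Prop :=
  C `<=` D /\ forall x, D x -> exists2 y, C y & le x y.

(* The least cardinality of a cofinal subset of [D] is aleph_1. *)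
Definition has_cofinality_omega1 (T : Type) (le : T -> T -> Prop) (D : set T) :
    Prop :=
  (exists2 C, cofinal_in le D C & has_card_aleph1 C) /\
  (forall C, cofinal_in le D C -> omega1 #<= C).

Section BooleanAlgebra.
Context {d : Order.disp_t} (B : ctbDistrLatticeType d).
Implicit Types (A S : set B) (F C : set (set B)).
Local Open Scope order_scope.

Definition subalgebra A : Prop :=
  [/\ A \bot, A \top,
      forall a b, A a -> A b -> A (a `&` b)%O,
      forall a b, A a -> A b -> A (a `|` b)%O
    & forall a, A a -> A (~` a)%O].

Definition aleph0_ideal A : Prop :=
  subalgebra A /\
  forall b, ~ A b ->
    exists2 C : set B, countable C &
      cofinal_in (fun x y => x <= y) [set a | A a /\ a < b] C.

Definition aleph1_aleph0_ideal : Prop :=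
  exists F : set (set B),
    [/\ forall A, F A -> aleph0_ideal A /\ has_card_aleph1 A,
        forall S, has_card_aleph1 S -> exists2 A, F A & (S `<=` A)%classic
      & forall C, (C `<=` F)%classic -> total_on C subset ->
          has_cofinality_omega1 subset C -> F (\bigcup_(A in C) A)%classic].

End BooleanAlgebra.

(* Main.v *)
Require Import Defs.
From mathcomp Require Import all_boot all_order.
From mathcomp Require Import all_classical topology.
From mathcomp Require wochoice.
Set Implicit Arguments.
Unset Strict Implicit.
Unset Printing Implicit Defensive.

Local Open Scope classical_set_scope.
Local Open Scope card_scope.

(** Every point [x] of [X] turns out to be determined by at most aleph_1 subsets
    of [nat]: there is a family [P] of that size such that [x] is the only point
    lying in the closure of [e @` a] for every [a] in [P]
    ([exists_determining_family]). Indexing [P] injectively by elements of [omega1]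
    lets a subset of [omega1] code it, because [omega1] times [nat] injects
    into [omega1] ([exists_omega1_pairing]); hence the bound [2 ^ aleph_1].

    For [x] outside the range of [e], take a free ultrafilter [p] on [nat] along
    which [e] converges to [x], and look for an aleph_0-ideal subalgebra [A] of
    size aleph_1 that is rich: for each countable [C] included in [A] there is a
    sequence [s] of integers, with [e \o s] convergent, that eventually avoids
    each member of [C] not in [p], and all of whose tails belong to [A]. Then
    [P := A `&` p] determines [x] ([ultrafilter_trace_separates]). Indeed let
    [y <> x] lie in all the closures, and let [U], [V] be neighbourhoods of [x],
    [y] with disjoint closures. The elements of [A] disjoint from [e @^-1` U]
    are not in [p], which contains [e @^-1` U]; those disjoint from [e @^-1` V]
    are not in [p] either, by the choice of [y]. Both ideals of [A] have
    countable cofinal subsets, and richness gives a sequence [s] eventually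
    avoiding every element of both. But its limit is outside one of the two
    closures, so some tail of [s] misses [e @^-1` U] or [e @^-1` V]; that tail
    is in [A], hence below one of the generators, which [s] should avoid.

    A sequence serving one countable [C] is a pseudo-intersection of the
    complements of the members of [C] outside [p], thinned out to a convergent
    one ([exists_cvg_escaping]). Closing a set of size aleph_1 under this
    operation takes only aleph_1 sequences, since its countable subsets are
    covered by aleph_1 countable ones ([exists_countable_cofinal_cover]).
    Iterating along [omega1] and taking the union, which stays in the given
    family of subalgebras, yields a rich [A] ([exists_reflecting]). *)

(** * The first uncountable ordinal *)

Definition below (x : set nat) : set (set nat) :=
  [set y | set_nat_le y x /\ y <> x].

Lemma set_nat_le_refl x : set_nat_le x x.
Proof. exact: (wochoice.wo_chain_reflexive set_nat_le_chain). Qed.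

Lemma set_nat_le_anti x y : set_nat_le x y -> set_nat_le y x -> x = y.
Proof.
move=> xy yx; apply: (wochoice.wo_chain_antisymmetric set_nat_le_chain) => //.
by rewrite xy.
Qed.

Lemma set_nat_le_trans x y z :
  set_nat_le x y -> set_nat_le y z -> set_nat_le x z.
Proof.
move=> xy yz.
have [|m [[/asboolP mE mmin] _]] :=
    set_nat_le_wo (A := [pred t | `[< [\/ t = x, t = y | t = z] >]]).
  by exists x; apply/asboolP; constructor.
have mx : set_nat_le m x by apply: mmin; apply/asboolP; constructor.
have my : set_nat_le m y by apply: mmin; apply/asboolP; constructor.
have mz : set_nat_le m z by apply: mmin; apply/asboolP; constructor.
case: mE => mE; rewrite -{}mE in xy yz *; rewrite //.
- by rewrite (set_nat_le_anti xy mx).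
- by rewrite -(set_nat_le_anti yz my).
Qed.

Lemma below_total x y : set_nat_le x y \/ below x y.
Proof.
have /orP[|yx] : set_nat_le x y || set_nat_le y x.
  exact: (wochoice.wo_chainW set_nat_le_chain).
- by left.
have [->|xy] := pselect (y = x); first by left; exact: set_nat_le_refl.
by right.
Qed.

Lemma below_wf : well_founded (fun y x => below x y).
Proof.
move=> x; apply: contrapT => nx.
have [|m [[mN mmin] _]] := set_nat_le_wo
    (A := [pred y | `[< ~ Acc (fun y x => below x y) y >]]).
  by exists x; apply/asboolP.
move: mN => /asboolP; apply; constructor => y [ym yNm].
apply: contrapT => ny; apply: yNm; apply: set_nat_le_anti ym _.
by apply: mmin; apply/asboolP.
Qed.

(** Transfinite recursion, in the weak form in which each value depends only on
    the set of the earlier values; every construction along [omega1] below has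
    this form. *)
Lemma exists_below_rec (T : Type) (step : set T -> T) :
  exists f : set nat -> T, forall x, f x = step (f @` below x).
Proof.
pose F x (h : forall y, below x y -> T) :=
  step [set t | exists y (yx : below x y), h y yx = t].
exists (Fix below_wf (fun=> T) F) => x.
rewrite Fix_eq => [|{}x g h gh]; congr step; apply/seteqP; split => t /=.
- by move=> [y [yx <-]]; exists y.
- by move=> [y yx <-]; exists y, yx.
- by move=> [y [yx <-]]; exists y, yx; rewrite gh.
- by move=> [y [yx <-]]; exists y, yx; rewrite gh.
Qed.

Lemma countable_below x : omega1 x -> countable (below x).
Proof. by apply: sub_countable; apply: subset_card_le => y []. Qed.

Lemma omega1_below x y : omega1 x -> below x y -> omega1 y.
Proof.
move=> Ox [yx _]; apply: sub_countable (Ox); apply: subset_card_le => z /= zy.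
exact: set_nat_le_trans yx.
Qed.

(** Regularity of [omega1]: if [D] were unbounded, [omega1] would be the union of
    the countably many countable segments given by the points of [D]. *)
Lemma omega1_bounded (D : set (set nat)) :
  countable D -> D `<=` omega1 -> exists2 z, omega1 z & D `<=` below z.
Proof.
move=> cD DO; apply: contrapT => nz; apply: uncountable_omega1.
apply: (@sub_countable _ _ _ (\bigcup_(x in D) [set y | set_nat_le y x])).
  apply: subset_card_le => z Oz; apply: contrapT => nDz.
  apply: nz; exists z => // x Dx.
  by have [zx|//] := below_total z x; case: nDz; exists x.
by apply: bigcup_countable => // x /DO.
Qed.

(** * Sets of cardinality at most aleph_1 *)

Lemma le_aleph1P (T : Type) (A : set T) :
  A #<= omega1 <->
  exists2 g : T -> set nat, (forall a, A a -> omega1 (g a)) &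
    forall a b, A a -> A b -> g a = g b -> a = b.
Proof.
split=> [/pcard_leP/injfunPex[g gO gi]|[g gO gi]].
  by exists g => // a b Aa Ab; apply: gi; rewrite inE.
apply/pcard_leP/injfunPex; exists g => // a b.
by rewrite !inE; exact: gi.
Qed.

Lemma countable_setU (T : Type) (A B : set T) :
  countable A -> countable B -> countable (A `|` B).
Proof.
move=> cA cB; apply: (@sub_countable _ _ _
  (\bigcup_(b in [set: bool]) (if b then A else B))).
  by apply: subset_card_le => t [At|Bt]; [exists true | exists false].
by apply: bigcup_countable => // -[].
Qed.

(** Choose recursively, at each stage, an element of [D] not chosen before: only
    countably many have been used up. *)
Lemma omega1_le_uncountable (T : Type) (D : set T) :
  ~ countable D -> omega1 #<= D.
Proof.
move=> uD.
have [t0 _] : D !=set0.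
  by apply: contrapT => /set0P/negP/negPn/eqP D0; apply: uD; rewrite D0.
have /choice[step stepP] : forall E : set T, exists t,
    countable E -> D t /\ ~ E t.
  move=> E; apply: contrapT => /forallNP nt; apply: uD.
  have cE : countable E.
    by apply: contrapT => ncE; apply: (nt t0).
  apply: sub_countable cE; apply: subset_card_le => t Dt.
  by apply: contrapT => nEt; apply: (nt t).
have [f fE] := exists_below_rec step.
have fP x : omega1 x -> D (f x) /\ ~ (f @` below x) (f x).
  move=> Ox; rewrite fE; apply: stepP.
  by apply: sub_countable (countable_below Ox); exact: card_image_le.
have fi x y : omega1 x -> omega1 y -> f x = f y -> x = y.
  move=> Ox Oy fxy; apply: contrapT => xy.
  have [yx|] := below_total y x.
  - by apply: (fP _ Ox).2; exists y => //; split=> // yx'; apply: xy.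
  - by move=> xy'; apply: (fP _ Oy).2; exists x.
apply: (@card_le_trans _ _ _ (f @` omega1)); last first.
  by apply: subset_card_le => _ [x Ox <-]; exact: (fP _ Ox).1.
have : f @` omega1 #= omega1.
  by apply: inj_card_eq => x y; rewrite !inE; exact: fi.
by rewrite card_eq_le => /andP[].
Qed.

(** The equality aleph_1 * aleph_0 = aleph_1 by recursion: each stage [x] picks a
    whole injective sequence [fun n => k (x, n)] in [omega1] avoiding the
    countably many values taken at earlier stages. *)
Lemma exists_omega1_pairing : exists2 k : set nat * nat -> set nat,
  (forall x n, omega1 x -> omega1 (k (x, n))) &
  forall x y m n, omega1 x -> omega1 y -> k (x, m) = k (y, n) ->
    x = y /\ m = n.
Proof.
have /choice[step stepP] : forall E : set (nat -> set nat),
    exists s : nat -> set nat, countable E ->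
    [/\ injective s, forall n, omega1 (s n)
      & forall t m n, E t -> s m <> t n].
  move=> E; have [cE|ncE] := pselect (countable E); last by exists (fun=> set0).
  pose D := omega1 `\` \bigcup_(t in E) range t.
  have iD : infinite_set D.
    move=> fD; apply: uncountable_omega1.
    apply: (@sub_countable _ _ _ (D `|` \bigcup_(t in E) range t)).
      apply: subset_card_le => z Oz.
      have [Ez|nEz] := pselect ((\bigcup_(t in E) range t) z); last by left.
      by right.
    apply: countable_setU; first exact: finite_set_countable.
    apply: bigcup_countable => // t _.
    by apply: sub_countable (card_image_le _ _) _.
  move/infiniteP/pcard_leP/injfunPex : iD => [s sD si]; exists s => _.
  split=> [m n smn|n|t m n Et smn].
  - by apply: si; rewrite ?inE.
  - by have [] := sD n I.
  - by have [_] := sD m I; apply; exists t => //; exists n.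
have [f fE] := exists_below_rec step.
have fP x : omega1 x -> [/\ injective (f x), forall n, omega1 (f x n)
      & forall y m n, below x y -> f x m <> f y n].
  move=> Ox; have /stepP : countable (f @` below x).
    by apply: sub_countable (countable_below Ox); exact: card_image_le.
  rewrite -fE => -[fi fO fd]; split=> // y m n yx.
  by apply: fd; exists y.
exists (fun p => f p.1 p.2) => /= [x n Ox|x y m n Ox Oy fxy].
  by have [] := fP _ Ox.
have xy : x = y.
  apply: contrapT => xy; have [yx|xy'] := below_total y x.
  - have [_ _ d] := fP _ Ox; apply: (d y m n) => //.
    by split=> // yx'; apply: xy.
  - by have [_ _ d] := fP _ Oy; apply: (d x n m).
split=> //; rewrite -{}xy in fxy.
by have [fi _ _] := fP _ Ox; apply: fi.
Qed.

Lemma bigcup_le_aleph1 (I T : Type) (D : set I) (G : I -> set T) :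
  countable D -> (forall i, D i -> G i #<= omega1) ->
  \bigcup_(i in D) G i #<= omega1.
Proof.
move=> /countable_injP[h hi] GO.
have [k kO ki] := exists_omega1_pairing.
have /choice[g gP] : forall i, exists g : T -> set nat, D i ->
    (forall a, G i a -> omega1 (g a)) /\
    forall a b, G i a -> G i b -> g a = g b -> a = b.
  move=> i; have [/GO/le_aleph1P[g gO gi]|nDi] := pselect (D i).
    by exists g.
  by exists (fun=> set0).
have /choice[c cP] : forall t, exists x, (\bigcup_(i in D) G i) t ->
    exists2 i, D i /\ G i t & x = k (g i t, h i).
  move=> t; have [[i Di Git]|nt] := pselect ((\bigcup_(i in D) G i) t).
    by exists (k (g i t, h i)) => _; exists i.
  by exists set0.
apply/le_aleph1P; exists c => [t /cP[i [Di Git] ->]|t u].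
  by apply: kO; apply: (gP i Di).1.
move=> /cP[i [Di Git] ->] /cP[j [Dj Gju] ->] /ki[].
- exact: (gP i Di).1.
- exact: (gP j Dj).1.
move=> gg /hi; rewrite !inE => /(_ Di Dj) ij; subst j.
exact: (gP i Di).2 gg.
Qed.

(** The countable subsets of [A] may number continuum many, but aleph_1 countable
    subsets suffice to cover them: the initial segments of an enumeration of [A]
    by elements of [omega1]. *)
Lemma exists_countable_cofinal_cover (T : Type) (A : set T) :
  A #<= omega1 ->
  exists2 K : set nat -> set T,
    (forall x, omega1 x -> countable (K x) /\ K x `<=` A) &
    forall C, countable C -> C `<=` A -> exists2 x, omega1 x & C `<=` K x.
Proof.
move=> /le_aleph1P[g gO gi].
exists (fun x => A `&` [set a | below x (g a)]) => [x Ox|C cC CA].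
  split; last by move=> a [].
  apply: sub_countable (countable_below Ox).
  apply: (@card_le_trans _ _ _ (g @` (A `&` [set a | below x (g a)]))).
    suff : g @` (A `&` [set a | below x (g a)]) #=
        A `&` [set a | below x (g a)] by rewrite card_eq_le => /andP[].
    by apply: inj_card_eq => a b; rewrite !inE => -[Aa _] [Ab _]; exact: gi.
  by apply: subset_card_le => _ [a [_ ax] <-].
have [|_ [c /CA Ac <-]|x Ox Cx] := @omega1_bounded (g @` C).
- by apply: sub_countable cC; exact: card_image_le.
- exact: gO.
by exists x => // c Cc; split; [exact: CA | apply: Cx; exists c].
Qed.

(** A closing-off argument, where [S A] is to be thought of as [A] together with
    witnesses for its countable subsets. If no member of [F] absorbs its own
    [S A], recursion produces a strictly increasing [omega1]-chain in [F], each
    term of which contains the [S A] of all earlier terms [A]. Strictness gives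
    the chain cofinality [omega1], so its union is in [F]; by regularity of
    [omega1] a countable subset of the union is included in one of the terms. *)
Lemma exists_reflecting (T : Type) (F : set (set T)) (S : set T -> set T) :
  (forall W, W #<= omega1 -> exists2 A, F A & W `<=` A) ->
  (forall C, C `<=` F -> total_on C subset ->
     has_cofinality_omega1 subset C -> F (\bigcup_(A in C) A)) ->
  (forall A, F A -> S A #<= omega1 /\ A `<=` S A) ->
  exists2 A, F A & forall C, countable C -> C `<=` A ->
    exists2 A0, F A0 & C `<=` A0 /\ S A0 `<=` A.
Proof.
move=> Fcov Fchain SP.
have [[A FA SA]|noA] := pselect (exists2 A, F A & S A `<=` A).
  by exists A => // C _ CA; exists A.
have /choice[step stepP] : forall E : set (set T), exists A,
    countable E -> E `<=` F -> F A /\ forall A', E A' -> S A' `<=` A.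
  move=> E; have [[cE EF]|nE] := pselect (countable E /\ E `<=` F); last first.
    by exists set0 => cE EF; case: nE.
  have [A FA EA] : exists2 A, F A & \bigcup_(A' in E) S A' `<=` A.
    by apply: Fcov; apply: bigcup_le_aleph1 => // A' /EF/SP[].
  by exists A => _ _; split=> // A' EA'; apply: subset_trans EA => t ?; exists A'.
have [f fE] := exists_below_rec step.
have fP x : omega1 x -> F (f x) /\ forall y, below x y -> S (f y) `<=` f x.
  elim/(well_founded_ind below_wf): x => x IH Ox.
  rewrite (fE x); have [| |Fx sx] := stepP (f @` below x).
  - by apply: sub_countable (countable_below Ox); exact: card_image_le.
  - by move=> _ [y yx <-]; apply: (IH y yx (omega1_below Ox yx)).1.
  - by split=> // y yx; apply: sx; exists y.
have Ff x : omega1 x -> F (f x) by case/fP.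
have Sf x y : omega1 x -> below x y -> S (f y) `<=` f x by case/fP => _; apply.
have ff x y : omega1 x -> below x y -> f y `<=` f x.
  move=> Ox yx; apply: subset_trans (Sf _ _ Ox yx).
  by apply: (SP _ _).2; apply: Ff; exact: omega1_below yx.
have fstrict x y : omega1 x -> below x y -> ~ f x `<=` f y.
  move=> Ox yx xy; apply: noA; exists (f y).
    by apply: Ff; exact: omega1_below yx.
  exact: subset_trans (Sf _ _ Ox yx) xy.
have fi x y : omega1 x -> omega1 y -> f x = f y -> x = y.
  move=> Ox Oy fxy; apply: contrapT => xy.
  have [yx|xy'] := below_total y x.
  - by apply: (@fstrict x y) => //; [split=> // /esym | rewrite fxy].
  - by apply: (@fstrict y x) => //; rewrite fxy.
have fcard D : D `<=` omega1 -> f @` D #= D.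
  move=> DO; apply: inj_card_eq => x y; rewrite !inE => /DO Ox /DO Oy.
  exact: fi.
exists (\bigcup_(A in f @` omega1) A).
  apply: Fchain => [_ [x Ox <-]|_ _ [x Ox <-] [y Oy <-]|]; first exact: Ff.
    have [[->|yx]|xy] : (x = y \/ below x y) \/ below y x; last 3 first.
    - by left.
    - by right; apply: ff.
    - by left; apply: ff.
    have [yx|] := below_total y x; last by right.
    by left; have [->|xy] := pselect (x = y); [left | right; split=> // /esym].
  split; first by exists (f @` omega1); [split=> // A fA; exists A|exact: fcard].
  (* A countable subfamily is bounded by some term [f z] of the chain, and is
     not cofinal, as no earlier term contains [f z]. *)
  move=> C [Cf Ccof]; apply: omega1_le_uncountable => cC.
  pose D := omega1 `&` (f @^-1` C).
  have DO : D `<=` omega1 by move=> x [].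
  have [|z Oz Dz] := @omega1_bounded D _ DO.
    apply: sub_countable cC; apply: (@card_le_trans _ _ _ (f @` D)).
      by move: (fcard D DO); rewrite card_eq_le => /andP[].
    by apply: subset_card_le => _ [x [_ Cx] <-].
  have [|A CA zA] := Ccof (f z); first by exists z.
  have [x Ox xA] := Cf _ CA; subst A.
  by apply: (@fstrict z x) => //; apply: Dz.
move=> C cC CU.
have /choice[r rP] : forall c, exists x, C c -> omega1 x /\ f x c.
  move=> c; have [/CU[_ [x Ox <-] xc]|nCc] := pselect (C c); first by exists x.
  by exists set0.
have [|_ [c /rP[Or _] <-]//|z Oz Cz] := @omega1_bounded (r @` C).
  by apply: sub_countable cC; exact: card_image_le.
have [|_ /= -> //|z' Oz' zz'] := @omega1_bounded [set z]; first exact: countable1.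
exists (f z); first exact: Ff.
split=> [c Cc|t Szt].
  by apply: (ff _ (r c)) => //; [apply: Cz; exists c | case: (rP c Cc)].
exists (f z'); first by exists z'.
by apply: Sf Szt => //; exact: zz'.
Qed.

(** * Points determined by few closures *)

Definition tail (s : nat -> nat) (n : nat) : set nat :=
  s @` [set m | (n <= m)%N].

Lemma finite_set_nat_bounded (D : set nat) :
  finite_set D -> exists N, forall n, D n -> (n < N)%N.
Proof.
move=> /finite_seqP[r ->]; exists (\max_(i <- r) i).+1 => n /= nr.
by rewrite ltnS; exact: leq_bigmax_seq.
Qed.

(** A free ultrafilter contains the intersection of finitely many complements of
    members of [C] outside it, even with an initial segment of [nat] removed.
    Picking the [k]-th point in the intersection of the first [k] of them gives
    a pseudo-intersection, whose infinite range contains a convergent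
    sequence. *)
Lemma exists_cvg_escaping (X : topologicalType) (e : nat -> X)
    (e_seq : forall S : set nat, infinite_set S ->
       exists (s : nat -> nat) (x : X),
         [/\ injective s, range s `<=` S & e (s n) @[n --> \oo] --> x])
    (p : set (set nat)) (pU : UltraFilter p) (p_free : forall n, p [set~ n])
    (C : set (set nat)) :
  countable C ->
  exists (s : nat -> nat) (z : X), e (s n) @[n --> \oo] --> z /\
    forall a, C a -> ~ p a -> \forall n \near \oo, ~ a (s n).
Proof.
move=> /countable_injP[h hi].
pose late k := [set n | (k <= n)%N /\
  forall a, C a -> ~ p a -> (h a < k)%N -> ~ a n].
have late_p k : p (late k).
  elim: k => [|k IH]; first by apply: filterS filterT => n _; split.
  have pk : p [set n | forall a, C a -> ~ p a -> h a = k -> ~ a n].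
    have [[a [Ca npa hak]]|noa] := pselect (exists a, [/\ C a, ~ p a & h a = k]).
      have [//|] := in_ultra_setVsetC a pU.
      apply: filterS => n nan b Cb _ hbk; suff -> : b = a by [].
      by apply: hi; rewrite ?inE ?hak.
    apply: filterS filterT => n _ a Ca npa hak.
    by case: noa; exists a.
  apply: filterS (filterI (filterI IH (p_free k)) pk).
  move=> n /= [[[kn late_n] nk] kk].
  split; first by rewrite ltn_neqAle kn andbT eq_sym; apply/eqP.
  move=> a Ca npa; rewrite ltnS leq_eqVlt => /orP[/eqP|]; first exact: kk.
  exact: late_n.
have /choice[t tP] : forall k, exists n, late k n.
  by move=> k; exact: filter_ex (late_p k).
have [|s [z [s_inj st ez]]] := e_seq (range t).
  move=> /finite_set_nat_bounded[N tN].
  have := tN (t N) (ex_intro2 _ _ N I erefl).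
  by rewrite ltnNge; have [-> _] := tP N.
exists s, z; split=> // a Ca npa.
have [|N aN] := @finite_set_nat_bounded (s @^-1` (t @` `I_(h a).+1)).
  apply: finite_preimage; first by move=> m n _ _; exact: s_inj.
  by apply: finite_image; exact: finite_II.
(* Only [t 0], ..., [t (h a)] can lie in [a], and [s] takes each of these values
   at most once. *)
exists N => // m /= Nm am.
have [k _ tk] := st (s m) (ex_intro2 _ _ m I erefl).
have /aN : (s @^-1` (t @` `I_(h a).+1)) m.
  exists k => //=; rewrite ltnS leqNgt; apply/negP => hak.
  by have [_ /(_ a Ca npa hak)] := tP k; rewrite tk.
by rewrite ltnNge Nm.
Qed.

(** Regularity need only shrink one of two disjoint open neighbourhoods: the
    closure of the other one already misses the first. *)
Lemma exists_disjoint_closures (X : topologicalType) (x y : X) :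
  regular_space X -> hausdorff_space X -> x <> y ->
  exists U V, [/\ nbhs x U, nbhs y V & closure U `&` closure V = set0].
Proof.
move=> regX; rewrite open_hausdorff => hX /eqP/hX[[U V] /=].
move=> [/set_mem Ux /set_mem Vy] [oU oV /eqP/disjoints_subset UV].
have [W xW WU] := regX x U (open_nbhs_nbhs (conj oU Ux)).
exists W, V; split=> //; first exact: open_nbhs_nbhs.
apply/seteqP; split=> // z [/WU Uz /(_ U (open_nbhs_nbhs (conj oU Uz)))].
by move=> [v [Vv Uv]]; exact: UV Uv Vv.
Qed.

(** The definition of an aleph_0-ideal subalgebra extended to all [b]: for [b] in
    [A], the ideal of the elements of [A] below [b] is generated by [b]. *)
Lemma aleph0_ideal_generators (A : set (set nat)) (b : set nat) :
  aleph0_ideal A ->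
  exists G : set (set nat), [/\ countable G,
    forall g, G g -> A g /\ g `<=` b &
    forall a, A a -> a `<=` b -> exists2 g, G g & a `<=` g].
Proof.
move=> [_ Aideal].
have [Ab|/[dup] nAb /Aideal[G cG [GA Gcof]]] := pselect (A b).
  exists [set b]; split=> [|g ->|a Aa ab]; [exact: countable1|by split|].
  by exists b.
exists G; split=> // [g /GA[Ag]|a Aa ab].
  by rewrite properEset => -[].
have [|g Gg] := Gcof a.
  split=> //; rewrite properEset; split=> // ba.
  by apply: nAb; rewrite (_ : b = a)//; apply/seteqP.
by rewrite subsetEset => ag; exists g.
Qed.

(** The heart of the proof. The hypothesis on [A] supplies a sequence that belongs
    to [A] through its tails while escaping countably many prescribed elements
    of [A] outside [p]; prescribing generators of the ideals of the elements of
    [A] that miss a neighbourhood of [x], resp. of [y], forces its limit into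
    the closures of both neighbourhoods. *)
Lemma ultrafilter_trace_separates (X : topologicalType) (e : nat -> X)
    (regX : regular_space X) (hausX : hausdorff_space X)
    (p : set (set nat)) (pU : UltraFilter p) (A : set (set nat)) (x y : X) :
  aleph0_ideal A ->
  (forall C, countable C -> C `<=` A ->
    exists (s : nat -> nat) (z : X), [/\ e (s n) @[n --> \oo] --> z,
      forall a, C a -> ~ p a -> \forall n \near \oo, ~ a (s n) &
      forall n, A (tail s n)]) ->
  (forall U, nbhs x U -> p (e @^-1` U)) ->
  (forall a, A a -> p a -> closure (e @` a) y) -> y = x.
Proof.
move=> Aideal Aseq px yA; apply: contrapT => yx.
have [|U [V [xU yV UV0]]] := @exists_disjoint_closures X x y regX hausX.
  by move=> xy; apply: yx.
have [G [cG GA Ggen]] := aleph0_ideal_generators (~` (e @^-1` U)) Aideal.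
have [H [cH HA Hgen]] := aleph0_ideal_generators (~` (e @^-1` V)) Aideal.
have Gp g : G g -> ~ p g.
  move=> /GA[_ gU] pg.
  by have [n [gn Un]] := filter_ex (filterI pg (px U xU)); exact: gU gn Un.
have Hp g : H g -> ~ p g.
  move=> /HA[Ag gV] pg.
  by have [_ [[n gn <-] Vn]] := yA g Ag pg V yV; exact: gV gn Vn.
have [||s [z [sz sC sA]]] := Aseq (G `|` H).
- exact: countable_setU.
- by move=> g [/GA[]|/HA[]].
(* If the limit [z] were outside the closure of [W], a tail of [s] would miss [W]
   and so lie below a generator [g]; but [s] eventually avoids [g]. *)
have key W K : (forall a, A a -> a `<=` ~` (e @^-1` W) ->
    exists2 g, K g & a `<=` g) ->
    (forall g, K g -> ~ p g) -> K `<=` G `|` H -> ~ closure W z -> False.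
  move=> Kgen Kp KGH; apply.
  move=> N /sz[n _ nN]; apply: contrapT => WN.
  have [|g Kg sg] := Kgen (tail s n) (sA n).
    move=> _ [m nm <-] Wm; apply: WN; exists (e (s m)); split=> //.
    exact: nN.
  have [k _ kg] := sC g (KGH g Kg) (Kp g Kg).
  apply: (kg (maxn n k)); first exact: leq_maxr.
  by apply: sg; exists (maxn n k) => //; exact: leq_maxl.
have Uz : closure U z.
  by apply: contrapT; apply: (key U G) => // g Gg; left.
have Vz : closure V z.
  by apply: contrapT; apply: (key V H) => // g Hg; right.
by have : (closure U `&` closure V) z by []; rewrite UV0.
Qed.

(** Density makes the traces on [nat] of the neighbourhoods of [x] a proper filter;
    any finer ultrafilter is free, as [x] is separated from each [e n]. *)
Lemma exists_free_ultrafilter (X : topologicalType) (e : nat -> X) (x : X) :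
  hausdorff_space X -> dense (range e) -> ~ range e x ->
  exists p : set (set nat), [/\ UltraFilter p, forall n, p [set~ n] &
    forall U, nbhs x U -> p (e @^-1` U)].
Proof.
move=> hausX e_dense nex.
pose F : set_system nat := filter_from (nbhs x) (fun U => e @^-1` U).
have FF : ProperFilter F.
  apply: filter_from_proper.
    apply: filter_from_filter; first by exists setT; exact: filterT.
    by move=> U V xU xV; exists (U `&` V) => //; exact: filterI.
  move=> U; rewrite nbhsE => -[O [oO Ox] OU].
  have [|q [Oq [n _ ny]]] := e_dense O _ oO; first by exists x.
  by exists n; apply: OU; rewrite ny.
have [p [pU Fp]] := ultraFilterLemma FF.
have px U : nbhs x U -> p (e @^-1` U) by move=> xU; apply: Fp; exists U.
exists p; split=> // n.
have /px : nbhs x (~` [set e n]).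
  apply: open_nbhs_nbhs; split=> /=; last by move=> xn; apply: nex; exists n.
  apply: closed_openC; apply: accessible_closed_set1.
  exact: hausdorff_accessible.
by apply: filterS => m /= nm mn; apply: nm; rewrite mn.
Qed.

(** A bound aleph_1 on the number of traces needed to pin down a point. In the
    range of [e] a singleton is enough; elsewhere the family is the trace on a
    rich subalgebra of an ultrafilter converging to the point. *)
Lemma exists_determining_family (X : topologicalType) (e : nat -> X)
    (hB : aleph1_aleph0_ideal (set nat))
    (regX : regular_space X) (hausX : hausdorff_space X)
    (e_dense : dense (range e))
    (e_seq : forall S : set nat, infinite_set S ->
       exists (s : nat -> nat) (x : X),
         [/\ injective s, range s `<=` S & e (s n) @[n --> \oo] --> x])
    (x : X) :
  exists P : set (set nat), [/\ P #<= omega1,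
    forall a, P a -> closure (e @` a) x &
    forall y, (forall a, P a -> closure (e @` a) y) -> y = x].
Proof.
have [[n _ <-]|nex] := pselect (range e x).
  have cl1 : closure (e @` [set n]) = [set e n].
    rewrite image_set1; apply/esym/closure_id/accessible_closed_set1.
    exact: hausdorff_accessible.
  exists [set [set n]]; split=> [|a ->|y /(_ _ erefl)]; rewrite ?cl1 //.
  apply/le_aleph1P.
  have [z Oz _] := omega1_bounded (countable0 _) (@sub0set _ _).
  by exists (fun=> z) => // a b -> ->.
have [p [pU p_free px]] := exists_free_ultrafilter hausX e_dense nex.
have [F [Fideal Fcov Fchain]] := hB.
pose captures S C := exists (s : nat -> nat) (z : X),
  [/\ e (s n) @[n --> \oo] --> z,
      forall a, C a -> ~ p a -> \forall n \near \oo, ~ a (s n) &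
      forall n, S (tail s n)].
have /choice[S SP] : forall A : set (set nat), exists S : set (set nat),
    A #<= omega1 -> [/\ S #<= omega1, A `<=` S &
      forall C, countable C -> C `<=` A -> captures S C].
  move=> A; have [A1|nA1] := pselect (A #<= omega1); last by exists A.
  have [K KA Kcov] := exists_countable_cofinal_cover A1.
  have /choice[s sP] : forall i, exists s : nat -> nat, omega1 i ->
      exists z : X, e (s n) @[n --> \oo] --> z /\
        forall a, K i a -> ~ p a -> \forall n \near \oo, ~ a (s n).
    move=> i; have [Oi|nOi] := pselect (omega1 i); last by exists id.
    have [s [z sz]] := exists_cvg_escaping e_seq pU p_free (KA i Oi).1.
    by exists s => _; exists z.
  (* [None] indexes [A] itself, [Some n] the tails from [n] of the sequences
     attached to the countable sets [K i]. *)
  pose tails n := (fun i => tail (s i) n) @` omega1.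
  exists (\bigcup_(k in [set: option nat]) (if k is Some n then tails n else A)).
  move=> _; split=> [|a Aa|C cC CA].
  - apply: bigcup_le_aleph1 => // -[n|] _ //; exact: card_image_le.
  - by exists None.
  have [i Oi Ci] := Kcov C cC CA.
  have [z [sz si]] := sP i Oi; exists (s i), z; split=> // [a /Ci|n].
    exact: si.
  by exists (Some n) => //; exists i.
have F1 A : F A -> A #<= omega1.
  by move=> /Fideal[_]; rewrite /has_card_aleph1 card_eq_le => /andP[].
have [|//||A FA Aref] := @exists_reflecting _ F S.
- move=> W W1; have [|A FA WA] := Fcov (W `|` omega1).
    rewrite /has_card_aleph1 card_eq_le; apply/andP; split.
      apply: card_le_trans (@bigcup_le_aleph1 bool _ setT
        (fun b => if b then W else omega1) _ _) => //; last by case.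
      apply: subset_card_le => w [Ww|Ow]; [by exists true | by exists false].
    by apply: subset_card_le => w Ow; right.
  by exists A => // w Ww; apply: WA; left.
- by move=> A /F1/SP[].
exists (A `&` p); split=> [|a [_ pa] U xU|y yA].
- by apply: card_le_trans (F1 _ FA); apply: subset_card_le => a [].
- have [n [an Un]] := filter_ex (filterI pa (px U xU)).
  by exists (e n); split=> //; exists n.
apply: (ultrafilter_trace_separates regX hausX pU (e := e) (A := A)) => //.
- exact: (Fideal A FA).1.
- move=> C cC CA; have [A0 FA0 [CA0 SA0]] := Aref C cC CA.
  have [_ _ /(_ C cC CA0)[s [z [sz sC sS]]]] := SP A0 (F1 _ FA0).
  by exists s, z; split=> // n; apply: SA0.
- by move=> a Aa pa; apply: yA.
Qed.

Theorem theorem3p5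
    (hB : aleph1_aleph0_ideal (set nat))
    (X : topologicalType) (regX : regular_space X) (hausX : hausdorff_space X)
    (e : nat -> X) (e_inj : injective e) (e_dense : dense (range e))
    (e_seq : forall S : set nat, infinite_set S ->
       exists (s : nat -> nat) (x : X),
         [/\ injective s, range s `<=` S & e (s n) @[n --> \oo] --> x]) :
  card_le_exp2_aleph1 [set: X].
Proof.
have /choice[P PP] :=
  exists_determining_family hB regX hausX e_dense e_seq.
have /choice[g gP] : forall x, exists g : set nat -> set nat,
    (forall a, P x a -> omega1 (g a)) /\
    forall a b, P x a -> P x b -> g a = g b -> a = b.
  by move=> x; have [/le_aleph1P[g gO gi] _ _] := PP x; exists g.
have [k kO ki] := exists_omega1_pairing.
(* With [g x] injecting [P x] into [omega1], the slice of [code x] over [g x a] is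
   [a], for [a] in [P x]. *)
pose code x := [set c | exists2 a, P x a & exists2 n, a n & c = k (g x a, n)].
have code_sub x y : code x = code y -> P x `<=` P y.
  move=> xy a Pa.
  have slice u v b c : code u = code v -> P u b -> P v c -> g u b = g v c ->
      b `<=` c.
    move=> uv Pb Pc bc n bn.
    have : code v (k (g u b, n)) by rewrite -uv; exists b => //; exists n.
    move=> [c' Pc' [m c'm /ki[]]].
    - exact: (gP u).1.
    - exact: (gP v).1.
    move=> gbc' ->; suff -> : c = c' by [].
    by apply: (gP v).2 => //; rewrite -bc.
  (* Members of [P x] are nonempty, so that their slices are visible. *)
  have [_ /(_ a Pa) xa _] := PP x.
  have [_ [[n an _] _]] := xa setT filterT.
  have : code y (k (g x a, n)) by rewrite -xy; exists a => //; exists n.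
  move=> [b Pb [m bm /ki[]]].
  - exact: (gP x).1.
  - exact: (gP y).1.
  move=> gab _; suff -> : a = b by [].
  apply/seteqP; split; first exact: (slice x y).
  by apply: (slice y x).
apply/pcard_leP/injfunPex; exists code => [x _ c [a Pa [n _ ->]]|x y _ _ xy].
  by apply: kO; exact: (gP x).1.
have [_ _ x_unique] := PP x; have [_ y_cl _] := PP y.
by apply/esym/x_unique => a /(code_sub _ _ xy); exact: y_cl.
Qed.
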